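(* As formal power series in $q$, $$\sum_{\pi\in\mathcal{G}\mathcal{G}_2} \omega_2(\pi)\, q^{|\pi|} = \sum_{\pi\in\mathcal{P}_{rdo}} q^{|\pi|},$$ where the sets of partitions $\mathcal{G}\mathcal{G}_2$, $\mathcal{P}_{rdo}$ and the weight $\omega_2$ are as defined in the context.
   Context: A partition $\pi=(\lambda_1,\lambda_2,\dots,\lambda_{\nu(\pi)})$ is a finite non-increasing sequence of positive integers (its parts); $\nu(\pi)$ is the number of parts and $|\pi|$ is the sum of the parts. The empty sequence is the unique partition of $0$. In frequency notation $\pi=(1^{f_1},2^{f_2},\dots)$, $f_i$ is the number of occurrences of $i$ as a part of $\pi$. $\mathcal{G}\mathcal{G}_2$ is the set of partitions into parts $\geq 3$ such that the difference between any two consecutive parts is $\geq 2$ and no two consecutive even numbers (i.e. $2k$ and $2k+2$) both appear as parts. Weight: let $\delta_{n,e}=1$ if $n$ is even and $0$ otherwise, and set $\lambda_{\nu(\pi)+1}:=0$ (so $\delta_{\lambda_{\nu(\pi)+1},e}=1$). Then $$\omega_2(\pi):=\prod_{i=1}^{\nu(\pi)} \frac{\lambda_i-\lambda_{i+1}-\delta_{\lambda_i,e}-\delta_{\lambda_{i+1},e}}{2},$$ with the empty product equal to $1$ (weight of the empty partition). $\mathcal{P}_{rdo}$ is the set of partitions in which odd parts are distinct (even parts may repeat), the smallest part is $>1$ (the empty partition is included), and, if the smallest part is $2$, then for some positive integer $j$ the partition $\pi$ starts in one of the following two ways: (1) $\pi=(2^{f_2},4^{f_4},6^{f_6},\dots,(4j-2)^{f_{4j-2}},(4j-1)^1,\dots)$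 with $f_2,f_4,\dots,f_{4j-2}$ all positive; that is, all of $2,4,\dots,4j-2$ occur as parts, $4j-1$ occurs exactly once, and no odd number less than $4j-1$ occurs; or (2) $\pi=(2^{f_2},4^{f_4},6^{f_6},\dots,(4j)^{f_{4j}},(4j+1)^0,(4j+2)^0,\dots)$ with $f_2,f_4,\dots,f_{4j}$ all positive; that is, all of $2,4,\dots,4j$ occur as parts, and neither $4j+2$ nor any odd number $\leq 4j+1$ occurs. *)

(* Defs.v *)
From mathcomp Require Import all_boot all_order all_algebra.

Set Implicit Arguments.
Unset Strict Implicit.
Unset Printing Implicit Defensive.

Import GRing.Theory.

Definition is_partition (p : seq nat) : bool := sorted geq p && (0 \notin p).

(* Partitions of n with all parts <= m, sorted by the multiplicity k of m. *)
Fixpoint partitions_le (m n : nat) : seq (seq nat) :=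
  if m is m'.+1 then
    flatten [seq [seq nseq k m ++ p | p <- partitions_le m' (n - k * m)]
            | k <- iota 0 (n %/ m).+1]
  else if n == 0 then [:: [::]] else [::].

Definition partitions (n : nat) : seq (seq nat) := partitions_le n n.

Definition freq (p : seq nat) (i : nat) : nat := count_mem i p.

(* A formal power series over rat is represented by its coefficient function;
   this is the sum of w p * q ^ |p| over the partitions p satisfying P. *)
Definition gen_series (P : pred (seq nat)) (w : seq nat -> rat) : nat -> rat :=
  fun n => (\sum_(p <- partitions n | P p) w p)%R.

Definition GG2 (p : seq nat) : bool :=
  [&& all (leq 3) p,
      sorted (fun a b => b + 2 <= a) p
    & all (fun a => ~~ odd a ==> (a + 2 \notin p)) p].

Definition delta_e (n : nat) : rat := ((~~ odd n)%:R)%R.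

(* Indices are shifted by one, and the default value of nth provides the
   convention that the part following the last one is 0. *)
Definition omega2 (p : seq nat) : rat :=
  (\prod_(i < size p)
     (((nth 0%N p i)%:R - (nth 0%N p i.+1)%:R
        - delta_e (nth 0%N p i) - delta_e (nth 0%N p i.+1)) / 2%:R))%R.

(* Among 1, ..., m exactly the even numbers occur as parts. *)
Definition starts_even (p : seq nat) (m : nat) : bool :=
  all (fun i => (0 < freq p i) == ~~ odd i) (iota 1 m).

Definition rdo_start1 (p : seq nat) (j : nat) : bool :=
  starts_even p (4 * j - 2) && (freq p (4 * j - 1) == 1).

Definition rdo_start2 (p : seq nat) (j : nat) : bool :=
  [&& starts_even p (4 * j), freq p (4 * j + 1) == 0 & freq p (4 * j + 2) == 0].

(* The range of j is cut at sumn p only for decidability, see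
   rdo_startP. *)
Definition Prdo (p : seq nat) : bool :=
  [&& all (fun i => odd i ==> (freq p i == 1)) p,
      all (ltn 1) p
    & (last 0 p == 2) ==>
        has (fun j => rdo_start1 p j || rdo_start2 p j) (iota 1 (sumn p))].

Lemma partition_split m p : sorted geq p -> all (geq m) p ->
  p = nseq (count_mem m p) m ++ filter (predC1 m) p.
Proof.
elim: p => //= a p IH hp /andP[ham hm].
case: (eqVneq a m) => [->|nam] /=.
  by congr (_ :: _); apply: IH => //; apply: path_sorted hp.
have hlt : all (fun x => x != m) p.
  move: hp; rewrite (path_sortedE (rev_trans leq_trans)) => /andP[/allP h _].
  apply/allP => x /h /= hxa; rewrite neq_ltn (leq_ltn_trans hxa) //.
  by rewrite ltn_neqAle nam.
rewrite add0n (_ : count_mem m p = 0); last first.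
  by apply/eqP; rewrite -leqn0 leqNgt -has_count -all_predC.
by rewrite /=; congr (_ :: _); apply/esym/all_filterP.
Qed.

Lemma mem_partitions_le m n p :
  (p \in partitions_le m n) = [&& is_partition p, all (geq m) p & sumn p == n].
Proof.
elim: m n p => [|m IH] n p.
  case: p => [|a p] /=; first by rewrite eq_sym; case: eqP.
  rewrite [X in _ = X](_ : _ = false); first by case: (n == 0).
  by rewrite /is_partition inE leqn0 eq_sym; case: eqP; rewrite /= ?andbF.
apply/flatten_mapP/idP => [[k hk /mapP[r]]|].
  rewrite IH => /and3P[/andP[sr r0] mr /eqP sumr] ->.
  move: hk; rewrite mem_iota /= add0n ltnS leq_divRL // => hk.
  rewrite /is_partition mem_cat negb_or r0 mem_nseq /= andbF /= andbT.
  rewrite sumn_cat sumn_nseq sumr mulnC subnKC // eqxx andbT all_cat all_nseq.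
  rewrite /= leqnn orbT /= (sub_all _ mr) ?andbT; last by move=> x /= /leqW.
  elim: k {hk sumr} => //= k; rewrite (path_sortedE (rev_trans leq_trans)) => ->.
  rewrite andbT all_cat all_nseq /= leqnn orbT /=.
  by apply: sub_all mr => x /= /leqW.
move=> /and3P[/andP[sp p0] mp /eqP sump].
have ep := partition_split sp mp; set k := count_mem _ _ in ep.
set r := filter _ _ in ep.
have en : n = m.+1 * k + sumn r by rewrite -sump {1}ep sumn_cat sumn_nseq.
exists k.
  by rewrite mem_iota /= add0n ltnS leq_divRL // en mulnC leq_addr.
apply/mapP; exists r => //; rewrite IH /is_partition.
rewrite sorted_filter //; last exact: (rev_trans leq_trans).
rewrite mem_filter (negPf p0) andbF en mulnC addKn eqxx andbT /= .
apply/allP => x; rewrite mem_filter /= => /andP[xm xp].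
by move/allP: mp => /(_ x xp) /=; rewrite leq_eqVlt (negPf xm) ltnS.
Qed.

Lemma mem_partitions n p :
  (p \in partitions n) = is_partition p && (sumn p == n).
Proof.
rewrite mem_partitions_le; case: (is_partition p) => //=.
rewrite andb_idl // => /eqP <-; elim: p {n} => //= a p IH.
rewrite leq_addr /=; apply: sub_all IH => x /= h.
exact: leq_trans h (leq_addl _ _).
Qed.

Lemma uniq_partitions n : uniq (partitions n).
Proof.
rewrite /partitions; move: {1}n => m; elim: m n => [|m IH] n /=.
  by case: (n == 0).
have nM k r n' : r \in partitions_le m n' -> count_mem m.+1 (nseq k m.+1 ++ r) = k.
  rewrite mem_partitions_le => /and3P[_ /allP mr _].
  rewrite count_cat count_nseq /= eqxx mul1n (_ : count_mem _ r = 0) ?addn0 //.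
  apply/count_memPn/negP => /mr /=; by rewrite ltnn.
apply: (allpairs_uniq_dep (f := fun k p => nseq k m.+1 ++ p)
  (s := iota 0 (n %/ m.+1).+1) (t := fun k => partitions_le m (n - k * m.+1))).
- exact: iota_uniq.
- by move=> k _; apply: IH.
move=> [k r] [k' r'] /allpairsPdep[k1 [r1 [_ hr [-> ->]]]].
move=> /allpairsPdep[k2 [r2 [_ hr' [-> ->]]]] /= e.
have ek : k1 = k2 by rewrite -(nM k1 _ _ hr) e (nM k2 _ _ hr').
by move: e; rewrite ek => /eqP; rewrite eqseq_cat // eqxx => /eqP ->.
Qed.

Lemma rdo_startP p :
  reflect (exists2 j, 0 < j & rdo_start1 p j || rdo_start2 p j)
          (has (fun j => rdo_start1 p j || rdo_start2 p j) (iota 1 (sumn p))).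
Proof.
have le_sumn i : 0 < freq p i -> i <= sumn p.
  rewrite /freq -has_count has_pred1; elim: p => //= a p IH.
  rewrite inE => /orP[/eqP->|/IH h]; first exact: leq_addr.
  exact: leq_trans h (leq_addl _ _).
have even_le m j : 0 < j -> starts_even p m -> j <= m -> j.*2 <= m ->
    j <= sumn p.
  move=> j0 /allP h _ jm; have := h j.*2; rewrite mem_iota double_gt0 j0 add1n.
  rewrite ltnS jm odd_double => /(_ isT) /eqP /le_sumn; apply: leq_trans.
  by rewrite -addnn leq_addr.
apply: (iffP hasP) => [[j]|[j j0 hj]].
  by rewrite mem_iota => /andP[j0 _]; exists j.
exists j => //; rewrite mem_iota j0 add1n ltnS /=.
have j2 : j.*2 <= 4 * j - 2.
  rewrite -[4]/(2 * 2) -mulnA !mul2n -[j.*2.*2]addnn.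
  by rewrite -addnBA ?leq_addr // (leq_double 1).
case/orP: hj => [/andP[h _]|/and3P[h _ _]]; apply: (even_le _ j j0 h) => //.
- by apply: leq_trans j2; rewrite -addnn leq_addr.
- by rewrite leq_pmull.
- exact: leq_trans j2 (leq_subr _ _).
Qed.

(* Main.v *)
Require Import Defs.
From mathcomp Require Import all_boot all_order all_algebra.
From mathcomp Require Import ring zify.

(* Write p = q^2 and b = -q, so that p = b^2.  Peeling off the smallest part of
   a partition in GG2 shows that those with n parts contribute
   q^(n^2+2n) (-q; p)_n / (p; p)_n^2.  On the other side, the indicator of Prdo
   is the alternating sum over m of the indicators of "odd parts are distinct,
   2, 4, ..., 2m occur, 1, 3, ..., 2m+1 do not", so the series of Prdo is
   1/(p; p)_oo * sum_m (-1)^m q^(m^2+m) (-q^(2m+3); p)_oo.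
   After multiplication by (p; p)_oo, Euler's expansion of (y; p)_oo turns both
   sides into series in q^(N^2+N), and comparing the coefficients leaves
     sum_(n <= N) b^n (b; p)_n / ((p; p)_n (p; p)_(N-n))
       = sum_(j <= N) b^j / (p; p)_j,
   which follows by induction on N from the q-binomial theorem because p = b^2.
   All series are taken in a ring where q is nilpotent, so that they are finite
   sums; the coefficient of q^n is read off in Q[X]/(X^(n+1)). *)

Set Implicit Arguments.
Unset Strict Implicit.
Unset Printing Implicit Defensive.

Import GRing.Theory.
Local Open Scope ring_scope.

(** * The q-series identity *)

Lemma sum_nat_shift (V : nmodType) (T u : nat) (g : nat -> V) :
  (forall j, (T <= u + j)%N -> g j = 0) ->
  \sum_(0 <= s < T | (u <= s)%N) g (s - u)%N = \sum_(0 <= j < T) g j.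
Proof.
move=> g0; have [uT|Tu] := leqP u T; last first.
  rewrite big_nat_cond big1; last by lia.
  by rewrite big1_seq // => i _; apply: g0; lia.
rewrite (big_cat_nat (n := u)) //= big_nat_cond big1 ?add0r; last by lia.
rewrite [RHS](big_cat_nat (n := T - u)) ?leq_subr //=.
rewrite [X in _ = _ + X]big_nat_cond [X in _ = _ + X]big1 ?addr0; last first.
  by move=> i hi; apply: g0; lia.
rewrite -{1}[u]add0n big_addn.
by apply: eq_big => [i|i _]; rewrite ?leq_addl ?addnK.
Qed.

(** Cauchy product along the diagonals: a square of indices may replace the triangle because the
    rest vanishes, which nilpotency of [q] will ensure. *)
Lemma sum_nat_triangle (V : nmodType) (T : nat) (f : nat -> nat -> V) :
  (forall i j, (T <= i + j)%N -> f i j = 0) ->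
  \sum_(0 <= i < T) \sum_(0 <= j < T) f i j
    = \sum_(0 <= n < T) \sum_(0 <= i < n.+1) f i (n - i)%N.
Proof.
move=> f0.
under eq_bigr => i _ do rewrite -(sum_nat_shift (f0 i)).
rewrite (exchange_big_dep xpredT) //=.
apply: eq_big_nat => n /andP[_ nT].
by rewrite [RHS](big_nat_widen _ _ T).
Qed.

Section NilpotentParameter.

Variables (A : comNzRingType) (q : A) (T : nat).
Hypothesis qT : q ^+ T = 0.

Lemma expr_nil k : (T <= k)%N -> q ^+ k = 0.
Proof. by move=> /subnK <-; rewrite exprD qT mulr0. Qed.

(** The inverse of [1 - q ^+ k] for positive [k]: all further terms of the geometric series are
    zero. *)
Definition geom (k : nat) : A := \sum_(0 <= i < T) q ^+ (k * i).

Lemma geomK k : (0 < k)%N -> (1 - q ^+ k) * geom k = 1.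
Proof.
move=> k0; rewrite /geom big_mkord -(opprB (q ^+ k)).
under eq_bigr => i _ do rewrite exprM.
rewrite mulNr -subrX1 -exprM expr_nil ?sub0r ?opprK //.
by rewrite leq_pmull.
Qed.

(* With [p = q^2]: [ipoch n] is 1/(p; p)_n and [poch n] is (-q; p)_n. *)
Definition ipoch (n : nat) : A := \prod_(0 <= i < n) geom i.+1.*2.
Definition poch (n : nat) : A := \prod_(0 <= i < n) (1 + q ^+ i.*2.+1).

Lemma ipoch0 : ipoch 0 = 1. Proof. by rewrite /ipoch big_geq. Qed.

Lemma ipochS n : ipoch n.+1 = ipoch n * geom n.+1.*2.
Proof. by rewrite /ipoch big_nat_recr. Qed.

Lemma pochS n : poch n.+1 = poch n * (1 + q ^+ n.*2.+1).
Proof. by rewrite /poch big_nat_recr. Qed.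

Lemma ipoch_rec n : (1 - q ^+ n.+1.*2) * ipoch n.+1 = ipoch n.
Proof. by rewrite ipochS mulrCA geomK ?mulr1. Qed.

(** Extracts the factor 1/(p; p)_T common to all n; what remains is a product to which Euler's
    expansion applies, with y = -p^(n+1). *)
Lemma ipoch_tail n : (n <= T)%N ->
  ipoch n = ipoch T * \prod_(0 <= i < T - n) (1 + q ^+ i.*2 * - q ^+ n.+1.*2).
Proof.
move=> nT; rewrite /ipoch (big_cat_nat (n := n) (leq0n _) nT) //= -mulrA.
have -> : \prod_(n <= i < T) geom i.+1.*2
    = \prod_(0 <= i < T - n) geom (i + n).+1.*2.
  by rewrite -{1}[n]add0n big_addn.
rewrite -big_split /=.
rewrite [X in _ * X]big1 ?mulr1 // => i _.
by rewrite mulrN -exprD -doubleD addnS mulrC geomK.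
Qed.

(* The q-binomial theorem, in the form
   sum_i [N, i]_p (b; p)_i b^(N - i) = 1 for b = -q. *)
Lemma cauchy_sum N :
  \sum_(0 <= i < N.+1) poch i * (- q) ^+ (N - i) * ipoch i * ipoch (N - i)
    = ipoch N.
Proof.
elim: N => [|N IH].
  by rewrite big_nat1 /poch big_geq // ipoch0 !mulr1.
rewrite -[LHS]mul1r -(@geomK N.+1.*2) // mulrAC mulrC ipochS mulrC -IH.
congr (_ * _).
pose F i := poch i * (- q) ^+ (N.+1 - i) * ipoch i * ipoch (N.+1 - i).
(* Uses 1 - p^(N+1) = (1 - p^i) + p^i (1 - p^(N+1-i)). The first sum loses its term i = 0, the
   second its term i = N+1, and each bracket lowers one of the two [ipoch] indices. *)
have -> : (1 - q ^+ N.+1.*2) * (\sum_(0 <= i < N.+2) F i)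
  = \sum_(0 <= i < N.+2) (1 - q ^+ i.*2) * F i
    + \sum_(0 <= i < N.+2) q ^+ i.*2 * (1 - q ^+ (N.+1 - i).*2) * F i.
  rewrite mulr_sumr -big_split /=; apply: eq_big_nat => i /andP[_ iN].
  have -> : N.+1.*2 = (i.*2 + (N.+1 - i).*2)%N by rewrite -doubleD subnKC.
  by rewrite exprD; ring.
rewrite big_nat_recl // expr0 subrr mul0r add0r.
rewrite [X in _ + X]big_nat_recr //= subnn subrr mulr0 mul0r addr0.
rewrite -big_split; apply: eq_big_nat => i /andP[_ iN] /=.
rewrite /F subSS subSn // -(ipoch_rec i) -(ipoch_rec (N - i)) pochS.
by rewrite !exprS; ring.
Qed.

Lemma conv_sum N :
  \sum_(0 <= i < N.+1) (- q) ^+ i * poch i * ipoch i * ipoch (N - i)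
    = \sum_(0 <= j < N.+1) (- q) ^+ j * ipoch j.
Proof.
elim: N => [|N IH]; first by rewrite !big_nat1 /poch big_geq // ipoch0 !mulr1.
(* The new term b^(N+1)/(p; p)_(N+1) on the right is expanded by the q-binomial theorem. *)
rewrite [RHS]big_nat_recr // -IH -cauchy_sum mulr_sumr /=.
rewrite big_nat_recr //= [X in _ = _ + X]big_nat_recr //= addrA -big_split /=.
congr (_ + _); last by rewrite subnn expr0; ring.
apply: eq_big_nat => i /andP[_ iN].
(* With r = N+1-i, b^(N+1) b^r = b^i p^r since p = b^2; the two contributions then add up by (1 -
   p^r) + p^r = 1. *)
have -> : (- q) ^+ N.+1 * (poch i * (- q) ^+ (N.+1 - i) * ipoch i
      * ipoch (N.+1 - i))
    = (- q) ^+ i * q ^+ (N.+1 - i).*2 * poch i * ipoch i * ipoch (N.+1 - i).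
  have -> : q ^+ (N.+1 - i).*2 = (- q) ^+ (N.+1 - i) * (- q) ^+ (N.+1 - i).
    by rewrite -exprD addnn -!mul2n !exprM sqrrN.
  have -> : (- q) ^+ N.+1 = (- q) ^+ i * (- q) ^+ (N.+1 - i).
    by rewrite -exprD subnKC // ltnW.
  by ring.
rewrite subSn // -(ipoch_rec (N - i)); ring.
Qed.

(** Euler's series for the product of all 1 + p^i y; [q ^+ (j * j.-1)] is p to the power binomial(j,
    2). *)
Definition euler_sum (y : A) : A :=
  \sum_(0 <= j < T) y ^+ j * q ^+ (j * j.-1) * ipoch j.

(** In the difference of the two series the factor 1 - p^j cancels against 1/(p; p)_j and shifts j
    by one; the term pushed out of range contains y^T. *)
Lemma euler_sum_rec y : y ^+ T = 0 ->
  euler_sum y = (1 + y) * euler_sum (q ^+ 2 * y).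
Proof.
move=> yT; apply/eqP; rewrite mulrDl mul1r addrC -subr_eq -sumrB.
apply/eqP; rewrite /euler_sum mulr_sumr.
(* The summation bound is separated from the [T] hidden in [ipoch], so that it alone can be
   split. *)
suff shift t : y ^+ t = 0 ->
    \sum_(0 <= j < t) (y ^+ j * q ^+ (j * j.-1) * ipoch j
       - (q ^+ 2 * y) ^+ j * q ^+ (j * j.-1) * ipoch j)
    = \sum_(0 <= j < t) y * ((q ^+ 2 * y) ^+ j * q ^+ (j * j.-1) * ipoch j).
  exact: shift.
case: t => [|t] yt; first by rewrite !big_geq.
rewrite big_nat_recl //= !expr0 subrr add0r [RHS]big_nat_recr //=.
rewrite [X in _ = _ + X](_ : _ = 0) ?addr0; last first.
  transitivity (y ^+ t.+1 * ((q ^+ 2) ^+ t * q ^+ (t * t.-1) * ipoch t)).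
    by rewrite exprMn [y ^+ t.+1]exprS; ring.
  by rewrite yt mul0r.
apply: eq_bigr => j _; rewrite -(ipoch_rec j) !exprMn.
have -> : (j.+1 * j = j + j + j * j.-1)%N by case: j => //= j; lia.
have -> : (j.+1.*2 = j.+1 + j.+1)%N by rewrite addnn.
rewrite !exprD !exprS; ring.
Qed.

(** M uses of the functional equation replace y by p^M y = 0, where the series equals 1. *)
Lemma euler_prod y M : (0 < T)%N -> y ^+ T = 0 -> q ^+ M.*2 * y = 0 ->
  \prod_(0 <= i < M) (1 + q ^+ i.*2 * y) = euler_sum y.
Proof.
move=> T0; elim: M y => [|M IH] y yT qy.
  rewrite big_geq //; rewrite mul1r in qy; rewrite qy /euler_sum.
  case: T T0 => // t _; rewrite big_nat_recl //= ipoch0 !mulr1 big1 ?addr0 //.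
  by move=> i _; rewrite exprS !mul0r.
rewrite big_nat_recl //= mul1r euler_sum_rec // -IH ?exprMn ?yT ?mulr0 //.
  congr (_ * _); apply: eq_bigr => i _.
  by rewrite mulrA -exprD addn2.
by rewrite mulrA -exprD addn2.
Qed.

Lemma weighted_series_identity : (0 < T)%N ->
  \sum_(0 <= n < T) q ^+ (n * n + 2 * n) * poch n * ipoch n * ipoch n
  = ipoch T * \sum_(0 <= m < T) (- 1) ^+ m * q ^+ (m * m.+1)
       * \prod_(0 <= i < T - m) (1 + q ^+ i.*2 * q ^+ (2 * m + 3)).
Proof.
move=> T0.
(* One of the two factors 1/(p; p)_n is completed to 1/(p; p)_T and its product expanded by Euler
   with index k; apart from the summand n, the exponent depends only on n + k. *)
transitivity (ipoch T * \sum_(0 <= n < T) \sum_(0 <= k < T)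
    (- 1) ^+ k * q ^+ ((n + k) * (n + k).+1 + n) * poch n * ipoch n * ipoch k).
  rewrite mulr_sumr; apply: eq_big_nat => n /andP[_ nT].
  rewrite {2}(ipoch_tail (ltnW nT)) euler_prod //; first last.
  - rewrite mulrN -exprD expr_nil ?oppr0 //; lia.
  - by rewrite exprNn -exprM expr_nil ?mulr0 //; nia.
  rewrite mulrCA /euler_sum !mulr_sumr; apply: eq_bigr => k _.
  rewrite [(- q ^+ _) ^+ k]exprNn -exprM.
  have -> : ((n + k) * (n + k).+1 + n
     = n * n + 2 * n + n.+1.*2 * k + k * k.-1)%N by case: k => [|k] /=; lia.
  by rewrite !exprD; ring.
congr (_ * _); rewrite sum_nat_triangle; last first.
  by move=> n k nk; rewrite expr_nil ?(mulr0, mul0r) //; nia.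
(* On the diagonal N the sign and the extra q^i combine into b^i, the form required by
   [conv_sum]. *)
have sgnq i N : (i <= N)%N ->
    (- 1) ^+ (N - i) * q ^+ (N * N.+1 + i)
      = (- 1) ^+ N * q ^+ (N * N.+1) * (- q) ^+ i.
  move=> iN; rewrite exprD [(- q) ^+ i]exprNn -(signr_odd _ (N - i)) oddB //.
  by rewrite signr_addb !signr_odd; ring.
transitivity (\sum_(0 <= N < T) (- 1) ^+ N * q ^+ (N * N.+1)
    * \sum_(0 <= j < N.+1) (- q) ^+ j * ipoch j).
  apply: eq_bigr => N _; rewrite -conv_sum mulr_sumr.
  apply: eq_big_nat => i /andP[_ iN]; rewrite subnKC // sgnq //.
  by ring.
(* The diagonal sum is opened again with N = j + m; for fixed m the sum over j is Euler's series at
   y = q^(2m+3). *)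
transitivity (\sum_(0 <= j < T) \sum_(0 <= m < T)
    (- 1) ^+ m * q ^+ ((j + m) * (j + m).+1 + j) * ipoch j).
  rewrite sum_nat_triangle; last first.
    by move=> n k nk; rewrite expr_nil ?(mulr0, mul0r) //; nia.
  apply: eq_bigr => N _; rewrite mulr_sumr.
  apply: eq_big_nat => i /andP[_ iN]; rewrite subnKC // sgnq //.
  by ring.
rewrite exchange_big_nat /=; apply: eq_big_nat => m /andP[_ mT].
rewrite euler_prod //; first last.
- by rewrite -exprD expr_nil //; lia.
- by rewrite -exprM expr_nil //; nia.
rewrite mulr_sumr; apply: eq_bigr => j _; rewrite -exprM.
have -> : ((j + m) * (j + m).+1 + j
   = m * m.+1 + (2 * m + 3) * j + j * j.-1)%N by case: j => [|j] /=; lia.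
by rewrite !exprD; ring.
Qed.

End NilpotentParameter.

(** * Weighted partitions in GG2 *)

Definition gg_gap (a b : nat) : bool := (b + 2 + ~~ odd a + ~~ odd b <= a)%N.

Lemma gg_trans : transitive gg_gap.
Proof. by rewrite /gg_gap => b a c; lia. Qed.

(** For parts of different parity a gap of at least 2 is already at least 3; for two even parts a
    gap of at least 4 excludes consecutive even numbers. The gap to the final 0 encodes that parts
    are at least 3. *)
Lemma GG2E p : GG2 p = sorted gg_gap (rcons p 0%N).
Proof.
apply/idP/idP => [/and3P[p3 sp hp]|].
  elim: p p3 sp hp => [|a p IH] //= /andP[a3 p3] sp /andP[_ hp].
  have hp' : all (fun a => ~~ odd a ==> (a + 2 \notin p)%N) p.
    apply: sub_all hp => x; case: (odd x) => //=.
    by rewrite inE negb_or => /andP[].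
  have {}IH := IH p3 (path_sorted sp) hp'.
  case: p p3 sp hp hp' IH => [|b p] /=; first by rewrite /gg_gap; lia.
  move=> _ /andP[ab _] /andP[bp _] _ ->.
  move: bp; rewrite inE eq_sym negb_or andbT /gg_gap; lia.
rewrite (sorted_pairwise gg_trans) -cats1 pairwise_cat allrel1r /= andbT.
move=> /andP[/allP p0 pp]; apply/and3P; split.
- by apply/allP => x /p0; rewrite /gg_gap /leq; lia.
- apply: sub_sorted (pairwise_sorted pp) => x y; rewrite /gg_gap /=; lia.
apply/allP => a ap; apply/implyP => ea; apply/negP => ap2.
(* Transitivity made the relation pairwise, so it compares [a] and [a + 2] even without knowing that
   they are adjacent. *)
have : gg_gap a (a + 2) || gg_gap (a + 2) a.
  elim: p pp ap ap2 {p0} => //= x p IH /andP[/allP xp pp].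
  rewrite !inE => /orP[/eqP ->|ap] /orP[/eqP E|ap2].
  - by move: E; lia.
  - by rewrite xp.
  - by rewrite E xp ?orbT.
  - exact: IH.
by rewrite /gg_gap; lia.
Qed.

(* The shift [c./2.*2] is even, and the gap between [a + c./2.*2] and [c] is, up
   to the parity corrections, the gap between [a] and the final 0. *)
Definition raise (c : nat) (p : seq nat) : seq nat :=
  rcons [seq (a + c./2.*2)%N | a <- p] c.

Lemma GG2_raise c p : (3 <= c)%N -> GG2 (raise c p) = GG2 p.
Proof.
move=> c3; rewrite !GG2E /raise; case: p => [|a p] /=.
  by rewrite /gg_gap; lia.
elim: p a => [|b p IH] a /=; first by rewrite /gg_gap; lia.
by rewrite IH; congr (_ && _); rewrite /gg_gap; lia.
Qed.

Lemma sumn_raise c p :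
  sumn (raise c p) = (sumn p + size p * c./2.*2 + c)%N.
Proof.
rewrite /raise -cats1 sumn_cat /= addn0; congr (_ + _)%N.
elim: p => //= a p ->; lia.
Qed.

Definition gap_weight (a b : nat) : rat :=
  (a%:R - b%:R - delta_e a - delta_e b) / 2%:R.

Definition omega2_to (t : nat) (p : seq nat) : rat :=
  \prod_(i < size p) gap_weight (nth t p i) (nth t p i.+1).

Lemma omega2_to_cons t a p :
  omega2_to t (a :: p) = gap_weight a (head t p) * omega2_to t p.
Proof. by rewrite /omega2_to /= big_ord_recl /= -nth0. Qed.

Lemma gap_weight_shift a b s :
  gap_weight (a + s.*2) (b + s.*2) = gap_weight a b.
Proof.
rewrite /gap_weight /delta_e !oddD !odd_double !addbF !natrD.
by congr (_ / _); ring.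
Qed.

Lemma gap_weight_last a c : (0 < c)%N ->
  gap_weight (a + c./2.*2) c = gap_weight a 0.
Proof.
move=> c0; rewrite /gap_weight /delta_e oddD odd_double addbF.
(* In this form the parity correction of [c] cancels, and the remaining 1 is the correction of the
   even number 0. *)
have -> : (c%:R : rat) = (c./2.*2)%:R + 1 - (~~ odd c)%:R.
  apply/eqP; rewrite eq_sym subr_eq natr1 -natrD; apply/eqP.
  by congr (_%:R); lia.
by rewrite natrD; congr (_ / _); rewrite /=; ring.
Qed.

(** The even shift preserves every factor of the weight of [p], including the one for its last gap;
    only the gap from [c] to 0 is new. *)
Lemma omega2_raise c p : (0 < c)%N ->
  omega2 (raise c p) = gap_weight c 0 * omega2 p.
Proof.
move=> c0; rewrite -![omega2 _]/(omega2_to 0 _) /raise.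
elim: p => [|a p IH] /=; first by rewrite omega2_to_cons.
rewrite !omega2_to_cons IH mulrCA; congr (_ * (_ * _)).
by case: p {IH} => [|b p] /=; rewrite ?gap_weight_last ?gap_weight_shift.
Qed.

(* The members of GG2 with k parts, up to a bound on the parts that excludes
   none of those of sum less than T. *)
Fixpoint GG2_list (T k : nat) : seq (seq nat) :=
  if k is k'.+1 then [seq raise c p | c <- iota 3 T.*2, p <- GG2_list T k']
  else [:: [::]].

Lemma mem_GG2_list T k p : (sumn p < T)%N ->
  (p \in GG2_list T k) = GG2 p && (size p == k).
Proof.
elim: k p => [|k IH] p pT; first by case: p pT => [|a p] //=; rewrite andbF.
apply/allpairsP/andP => /= [[[c p'] /= [hc hp' Ep]]|[]].
  move: pT; rewrite Ep sumn_raise => pT.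
  move: hp'; rewrite IH; last by lia.
  move=> /andP[gp' /eqP <-]; rewrite /raise size_rcons size_map; split=> //.
  by rewrite -/(raise c p') GG2_raise //; move: hc; rewrite mem_iota => /andP[].
case/lastP: p pT => [|p c] //; rewrite size_rcons eqSS => pT gp sp.
have := gp; rewrite GG2E (sorted_pairwise gg_trans) -!cats1 !pairwise_cat /=.
rewrite allrel_catl !allrel1r /= !andbT => /and3P[/andP[_ c0] /allP pc _].
have c3 : (3 <= c)%N by move: c0; rewrite /gg_gap; lia.
have cp : (c <= sumn (rcons p c))%N by rewrite -cats1 sumn_cat /=; lia.
(* Inverts [raise]; the subtraction is exact since all other parts exceed [c]. *)
have Ep : rcons p c = raise c [seq (a - c./2.*2)%N | a <- p].
  rewrite /raise -map_comp; congr rcons; apply/esym/map_id_in => a /pc.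
  by rewrite /gg_gap /=; lia.
exists (c, [seq (a - c./2.*2)%N | a <- p]); split=> //=; last by rewrite cats1.
  by rewrite mem_iota; lia.
rewrite IH ?size_map ?sp ?andbT; first by rewrite -(@GG2_raise c) // -Ep.
by move: pT; rewrite Ep sumn_raise; lia.
Qed.

Lemma uniq_GG2_list T k : uniq (GG2_list T k).
Proof.
elim: k => //= k IH; apply: allpairs_uniq => //; first exact: iota_uniq.
move=> [c p] [c' p'] _ _ /= /rcons_inj[e ec].
by move: e; rewrite ec => /inj_map -> // x y; lia.
Qed.

Lemma size_GG2_list T k p : p \in GG2_list T k -> size p = k.
Proof.
elim: k p => [|k IH] p /=; first by rewrite inE => /eqP ->.
move=> /allpairsP[[c p'] [_ /IH <- ->]].
by rewrite size_rcons size_map.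
Qed.

Section Generating.

Variables (A : comAlgType rat) (q : A) (T : nat).
Hypothesis qT : q ^+ T = 0.

(** The expansion of 1/(1 - x)^2 at x = q^k: multiplying a partial sum by 1 - x telescopes to a
    geometric sum. *)
Lemma sum_geom_deriv k : (0 < k)%N ->
  \sum_(0 <= g < T) q ^+ (k * g) *+ g.+1 = geom q T k * geom q T k.
Proof.
move=> k0.
have h n : (1 - q ^+ k) * \sum_(0 <= g < n) q ^+ (k * g) *+ g.+1
    = \sum_(0 <= g < n) q ^+ (k * g) - q ^+ (k * n) *+ n.
  elim: n => [|n IH]; first by rewrite !big_geq // mulr0 mulr0n subr0.
  rewrite !big_nat_recr //= mulrDr IH mulnS addnC exprD -!(mulr_natr (_ * _)).
  by rewrite -!(mulr_natr (q ^+ _)) -natr1; ring.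
have := h T; rewrite (expr_nil qT (leq_pmull T k0)) mul0rn subr0 => hT.
by rewrite -[LHS]mul1r -(geomK qT k0) mulrAC hT mulrC.
Qed.

(** The parts c = 2g+3 and c = 2g+4 have the same weight g+1, and their exponents differ by 2k+1.
    The range consists of [T] such pairs. *)
Lemma sum_last_part k :
  \sum_(c <- iota 3 T.*2) gap_weight c 0 *: q ^+ (k * c./2.*2 + c)
  = q ^+ (2 * k + 3) * (1 + q ^+ k.*2.+1)
      * (geom q T k.+1.*2 * geom q T k.+1.*2).
Proof.
rewrite -sum_geom_deriv // mulr_sumr.
elim: T => [|t IH]; first by rewrite !big_geq // big_nil.
have -> : t.+1.*2 = (t.*2 + 2)%N by lia.
rewrite iotaD big_cat IH big_nat_recr //=; congr (_ + _).
rewrite big_cons big_seq1.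
have wE c : (2 < c)%N -> gap_weight c 0 = ((c - 1)./2)%:R.
  move=> c2; rewrite /gap_weight /delta_e /= subr0.
  apply: (@mulIf _ 2%:R) => //; rewrite mulfVK //.
  rewrite -natrM -addrA -opprD -natrD; apply/eqP; rewrite subr_eq -natrD.
  by apply/eqP; congr (_%:R); lia.
rewrite !wE; [|lia|lia].
have -> : ((3 + t.*2 - 1)./2 = t.+1)%N by lia.
have -> : (((3 + t.*2).+1 - 1)./2 = t.+1)%N by lia.
rewrite !scaler_nat -mulrnDl mulrnAr; congr (_ *+ _).
rewrite mulrDr mulr1 mulrDl -!exprD.
by congr (_ ^+ _ + _ ^+ _); nia.
Qed.

(** Under [raise] the smallest part and the remaining k parts are chosen independently, so the
    series gains the factor [sum_last_part]. *)
Lemma GG2_list_series k :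
  \sum_(p <- GG2_list T k) omega2 p *: q ^+ sumn p
  = q ^+ (k * k + 2 * k) * poch q k * ipoch q T k * ipoch q T k.
Proof.
elim: k => [|k IH] /=.
  by rewrite big_seq1 /omega2 big_ord0 /poch big_geq // ipoch0 scale1r !mulr1.
rewrite big_allpairs_dep /= pochS ipochS.
transitivity ((\sum_(c <- iota 3 T.*2)
                 gap_weight c 0 *: q ^+ (k * c./2.*2 + c))
              * \sum_(p <- GG2_list T k) omega2 p *: q ^+ sumn p).
  rewrite mulr_suml big_seq [RHS]big_seq; apply: eq_bigr => c.
  rewrite mem_iota => /andP[c3 _].
  rewrite mulr_sumr big_seq [RHS]big_seq; apply: eq_bigr => p /size_GG2_list sp.
  rewrite omega2_raise ?(leq_trans _ c3) // sumn_raise sp.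
  by rewrite -scalerAl -scalerAr scalerA -exprD; congr (_ *: _ ^+ _); lia.
rewrite IH sum_last_part.
have -> : (k.+1 * k.+1 + 2 * k.+1 = (2 * k + 3) + (k * k + 2 * k))%N by lia.
by rewrite [q ^+ (_ + (k * k + _))]exprD; ring.
Qed.

End Generating.

(** * Partitions in Prdo *)

Definition freqs_in (a : nat -> pred nat) (M : nat) (p : seq nat) : bool :=
  all (fun i => a i (freq p i)) (iota 1 M).

Lemma freqs_in_cat a M k s p : p \in partitions_le M s ->
  freqs_in a M.+1 (nseq k M.+1 ++ p) = a M.+1 k && freqs_in a M p.
Proof.
rewrite mem_partitions_le => /and3P[_ /allP pM _].
have iotaE : iota 1 M.+1 = rcons (iota 1 M) M.+1.
  by rewrite -[M.+1]addn1 iotaD cats1 addnC.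
rewrite /freqs_in iotaE all_rcons; congr (a M.+1 _ && _).
  rewrite /freq count_cat count_nseq /= eqxx mul1n.
  by rewrite (count_memPn _) ?addn0 //; apply/negP => /pM /=; rewrite ltnn.
apply: eq_in_all => i; rewrite mem_iota => /andP[_ iM].
by rewrite /freq count_cat count_nseq /= gtn_eqF.
Qed.

Lemma partitions_leS m n : partitions_le m.+1 n =
  [seq nseq k m.+1 ++ p | k <- iota 0 (n %/ m.+1).+1,
                          p <- partitions_le m (n - k * m.+1)].
Proof. by []. Qed.

(** The m-th set of the alternating sum, expressed as a condition on the multiplicity [k] of each
    [i] separately so that its series is a product. *)
Definition allowed (m i k : nat) : bool :=
  if (i <= 2 * m + 1)%N then (0 < k)%N == ~~ odd i else odd i ==> (k <= 1)%N.

Section Product.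

Variables (A : comNzRingType) (q : A) (T : nat).
Hypotheses (qT : q ^+ T = 0) (T0 : (0 < T)%N).

(** Independent conditions on multiplicities: peeling off all copies of the largest part M+1 splits
    off one factor. *)
Lemma freqs_in_series (a : nat -> pred nat) M :
  \sum_(0 <= s < T) \sum_(p <- partitions_le M s | freqs_in a M p) q ^+ s
  = \prod_(0 <= i < M) \sum_(0 <= k < T | a i.+1 k) q ^+ (k * i.+1).
Proof.
elim: M => [|M IH].
  case: (T) T0 => // t _; rewrite big_nat_recl //= big_mkcond big_seq1 /=.
  rewrite big1 => [|i _]; last exact: big_nil.
  by rewrite addr0 big_geq.
rewrite big_nat_recr // -IH [X in _ = X]/=.
transitivity (\sum_(0 <= s < T) \sum_(0 <= k < T | a M.+1 k && (k * M.+1 <= s)%N)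
   \sum_(p <- partitions_le M (s - k * M.+1) | freqs_in a M p) q ^+ s).
  apply: eq_big_nat => s /andP[_ sT]; rewrite partitions_leS big_mkcond big_allpairs_dep.
  have sM : ((s %/ M.+1).+1 <= T)%N.
    by rewrite (leq_trans _ sT) // ltnS leq_div.
  rewrite -[X in iota _ X]subn0 -/(index_iota 0 _) (big_nat_widen _ _ _ _ _ sM).
  rewrite [RHS]big_mkcondl; apply: eq_big => [k|k _] /=.
    by rewrite ltnS leq_divRL.
  rewrite -big_mkcond big_seq_cond.
  case: ifP => ak; last first.
    by rewrite big1 // => p /andP[/(freqs_in_cat a k) ->]; rewrite ak.
  rewrite [RHS]big_seq_cond; apply: eq_bigl => p.
  by case: (boolP (p \in _)) => //= /(freqs_in_cat a k) ->; rewrite ak.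
rewrite (exchange_big_dep (a M.+1)) /=; last by move=> s k _ /andP[].
rewrite mulrC mulr_suml; apply: eq_bigr => k ak; rewrite ak /=.
pose g j := \sum_(p <- partitions_le M j | freqs_in a M p) q ^+ (k * M.+1 + j).
rewrite (eq_bigr (fun s => g (s - k * M.+1)%N)) => [|s ks]; last first.
  by rewrite /g subnKC.
rewrite sum_nat_shift => [|j jT]; last first.
  by apply: big1 => p _; rewrite (expr_nil qT).
rewrite mulr_sumr; apply: eq_bigr => j _; rewrite mulr_sumr.
by apply: eq_bigr => p _; rewrite exprD.
Qed.

Lemma sum_geom_pos k : (0 < k)%N ->
  \sum_(0 <= i < T | (0 < i)%N) q ^+ (i * k) = q ^+ k * geom q T k.
Proof.
move=> k0; rewrite /geom mulr_sumr; have kT : q ^+ (T * k) = 0.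
  by rewrite (expr_nil qT) // leq_pmulr.
case: (T) T0 kT => // t _ kT; rewrite big_mkcond big_nat_recl //= add0r.
rewrite [RHS]big_nat_recr //= -exprD -mulnS mulnC kT addr0.
by apply: eq_bigr => i _; rewrite -exprD -mulnS mulnC.
Qed.

Lemma sum_le1 k :
  \sum_(0 <= i < T | (i <= 1)%N) q ^+ (i * k.+1) = 1 + q ^+ k.+1.
Proof.
case: (T) T0 qT => // -[|t] _ q0.
  by rewrite big_mkcond big_nat1 exprS [q]q0 mul0r addr0.
by rewrite big_mkcond !big_nat_recl //= mul1n big1 ?addr0.
Qed.

Lemma allowed_prod m : (m <= T)%N ->
  \prod_(0 <= i < T.*2.+1) \sum_(0 <= k < T | allowed m i.+1 k) q ^+ (k * i.+1)
  = ipoch q T T * q ^+ (m * m.+1)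
    * \prod_(0 <= i < T - m) (1 + q ^+ i.*2 * q ^+ (2 * m + 3)).
Proof.
have none i : (i <= 2 * m + 1)%N -> odd i ->
    \sum_(0 <= k < T | allowed m i k) q ^+ (k * i) = 1.
  move=> im oi; case: (T) T0 => // t _; rewrite big_mkcond big_nat_recl //=.
  rewrite /allowed im oi big1 ?addr0 // => k _; by rewrite im.
have pairs n (F : nat -> A) :
    \prod_(0 <= i < n.*2) F i = \prod_(0 <= i < n) (F i.*2 * F i.*2.+1).
  elim: n => [|n IH]; first by rewrite !big_geq.
  by rewrite doubleS !big_nat_recr //= IH -mulrA.
(* The part 1 contributes 1. The others are grouped as 2i+2, 2i+3, which lie on the same side of the
   threshold 2m+1; for i < m the forced even parts give q^(2+4+...+2m). *)
move=> mT; rewrite big_nat_recl // none ?addn1 // mul1r pairs.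
transitivity (\prod_(0 <= i < T) (geom q T i.+1.*2
   * (if (i < m)%N then q ^+ i.+1.*2 else 1 + q ^+ i.+1.*2.+1))).
  apply: eq_bigr => i _; case: ifP => im.
    rewrite (none i.*2.+3) ?mulr1 //; [|lia|by rewrite /= odd_double].
    rewrite mulrC -sum_geom_pos //; apply: eq_bigl => k.
    by rewrite /allowed ifT ?eqb_id //= ?odd_double ?eqb_id //; lia.
  congr (_ * _).
    rewrite /geom; apply: eq_big => [k|k _]; last by rewrite mulnC.
    by rewrite /allowed ifF /= ?odd_double //; lia.
  rewrite -sum_le1 //; apply: eq_bigl => k.
  by rewrite /allowed ifF /= ?odd_double //; lia.
rewrite big_split /= -/(ipoch q T T) -mulrA; congr (_ * _).
rewrite (big_cat_nat (n := m)) //=; congr (_ * _).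
  rewrite (eq_big_nat _ _ (F2 := fun i => q ^+ i.+1.*2)); last first.
    by move=> i /andP[_ ->].
  elim: (m) => [|n IH]; first by rewrite big_geq.
  by rewrite big_nat_recr //= IH -exprD; congr (_ ^+ _); lia.
rewrite -{1}[m]add0n big_addn; apply: eq_bigr => i _.
by rewrite ifF -?exprD; [congr (_ + _ ^+ _); lia | lia].
Qed.

End Product.

Definition distinct_odds (p : seq nat) : bool :=
  all (fun i => odd i ==> (freq p i == 1%N)) p.

Lemma freq_gt0 p i : (0 < freq p i)%N = (i \in p).
Proof. by rewrite /freq -has_count has_pred1. Qed.

Lemma mem_le_sumn p i : i \in p -> (i <= sumn p)%N.
Proof. elim: p => //= a p IH; rewrite inE => /orP[/eqP ->|/IH]; lia. Qed.

Lemma freqs_in_allowed p m T : 0%N \notin p -> (sumn p < T)%N -> (m < T)%N ->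
  freqs_in (allowed m) T.*2.+1 p = distinct_odds p && starts_even p (2 * m + 1).
Proof.
move=> p0 pT mT; apply/allP/andP => [h|[/allP od /allP st]].
  split; apply/allP => i.
    move=> ip; apply/implyP => oi; have iT := mem_le_sumn ip.
    have := h i; rewrite mem_iota /allowed oi freq_gt0 ip /=.
    have := freq_gt0 p i; rewrite ip; case: ifP => _ ? /(_ _); lia.
  rewrite mem_iota => hi; have := h i; rewrite mem_iota /allowed ifT; last lia.
  by apply; lia.
move=> i; rewrite mem_iota /allowed => hi; case: ifP => im.
  by apply: st; rewrite mem_iota; lia.
apply/implyP => oi; have := od i; rewrite oi -freq_gt0 /=; lia.
Qed.

Lemma starts_evenS p m : starts_even p m.+1 =
  starts_even p m && ((m.+1 \in p) == ~~ odd m.+1).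
Proof.
by rewrite /starts_even -[X in iota _ X]addn1 iotaD all_cat /= andbT freq_gt0.
Qed.

Lemma last_eq2 p : is_partition p -> 1%N \notin p ->
  (last 0%N p == 2%N) = (2%N \in p).
Proof.
case/lastP: p => [|p c] //= /andP[sp p0] p1; rewrite last_rcons.
have := p0; have := p1; rewrite !mem_rcons !inE !negb_or.
move=> /andP[c1 _] /andP[c0 _]; rewrite [2%N == c]eq_sym.
case: (eqVneq c 2%N) => //= c2; apply/esym/negP => p2.
have: sorted geq (rcons p c) := sp.
rewrite (sorted_pairwise (rev_trans leq_trans)) -cats1 pairwise_cat allrel1r.
by move=> /andP[/allP /(_ _ p2) /=]; lia.
Qed.

Lemma starts_even_mem p m i : starts_even p m -> (0 < i <= m)%N ->
  (i \in p) = ~~ odd i.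
Proof.
move=> /allP h im; have := h i; rewrite mem_iota freq_gt0 add1n ltnS.
by move=> /(_ im) /eqP.
Qed.

Lemma starts_even_le p m n : (n <= m)%N -> starts_even p m -> starts_even p n.
Proof.
move=> nm st; apply/allP => i; rewrite mem_iota freq_gt0 => hi.
by apply/eqP/(starts_even_mem st); lia.
Qed.

(* Deciding [Prdo] from the length [h] of the initial run of indices m for which
   2, 4, ..., 2m occur in [p] and 1, 3, ..., 2m + 1 do not. *)
Lemma Prdo_odd p h : is_partition p ->
  (forall m, starts_even p (2 * m + 1) = (m < h)%N) ->
  Prdo p = distinct_odds p && odd h.
Proof.
move=> hp H; have /andP[_ p0] := hp.
rewrite /Prdo -/(distinct_odds p); case: (boolP (distinct_odds p)) => //= od.
have all1 : all (ltn 1) p = (1%N \notin p).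
  apply/allP/idP => [h1|p1 i ip]; first by apply/negP => /h1.
  by case: i ip => [|[|i]] // ip; rewrite ip in p0 p1.
rewrite all1; case: h H => [|M] H.
  by move: (H 0%N); rewrite /starts_even /= freq_gt0; case: (1%N \in p).
have p1 : 1%N \notin p.
  by move: (H 0%N); rewrite /starts_even /= freq_gt0; case: (1%N \in p).
rewrite p1 last_eq2 //=; apply/implyP/idP => [h2|oM p2].
  case: (boolP (2%N \in p)) => p2; last first.
    have := H 1%N; case: (M) => //= M' /(starts_even_mem (i := 2)) p2'.
    by rewrite p2' in p2.
  (* The run stops at a unique index: it is 2j-2 for the first kind of start, where 4j-1 occurs, and
     2j for the second, where 4j+2 is missing. *)
  have eqM m : starts_even p (2 * m + 1) -> ~~ starts_even p (2 * m.+1 + 1) ->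
      M = m.
    by rewrite !H; lia.
  case/rdo_startP: (h2 p2) => j j0 /orP[/andP[st f1]|/and3P[st f1 f2]].
    rewrite (eqM (2 * j - 2)%N); first by clear; lia.
      by apply: starts_even_le st; lia.
    apply/negP => /(starts_even_mem (i := 4 * j - 1)).
    by rewrite -freq_gt0 (eqP f1) => /(_ _)/esym; clear -j0; lia.
  rewrite (eqM (2 * j)%N); first by clear; lia.
    have -> : (2 * (2 * j) + 1 = (4 * j).+1)%N by clear; lia.
    by rewrite starts_evenS st -freq_gt0 -[(4 * j).+1]addn1 (eqP f1) /=; clear; lia.
  apply/negP => /(starts_even_mem (i := 4 * j + 2)).
  by rewrite -freq_gt0 (eqP f2) => /(_ _)/esym; clear -j0; lia.
apply/rdo_startP; have [i Mi] : exists i, M = (2 * i)%N by exists M./2; lia.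
have stM : starts_even p (4 * i + 1).
  by have := H M; rewrite ltnSn Mi mulnA.
have := H M.+1; rewrite ltnn (_ : 2 * M.+1 + 1 = (4 * i + 1).+2)%N; last lia.
have o4 : odd (4 * i + 1) by rewrite addn1 /= oddM.
(* The run breaks at 4i+2 or 4i+3. If 4i+2 occurs, so does 4i+3, giving the first start with j =
   i+1; otherwise the second start holds with j = i, positive because 2 occurs. *)
rewrite !starts_evenS stM /= o4 /=; case: (boolP ((4 * i + 1).+1 \in p)) => i2.
  case: (boolP (_ \in p)) => // i3 _.
  exists i.+1 => //; apply/orP; left; apply/andP; split.
    have -> : (4 * i.+1 - 2 = (4 * i + 1).+1)%N by clear; lia.
    by rewrite starts_evenS stM i2 /= o4.
  have -> : (4 * i.+1 - 1 = (4 * i + 1).+2)%N by clear; lia.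
  by have := allP od _ i3; rewrite /= o4.
move=> _; exists i.
  by case: (posnP i) i2 => // ->; rewrite p2.
apply/orP; right; apply/and3P; split.
- by apply: starts_even_le stM; lia.
- by rewrite -leqn0 leqNgt freq_gt0 (starts_even_mem stM) ?o4 // addn1 leqnn.
- by rewrite -leqn0 leqNgt freq_gt0 addnS.
Qed.

Lemma alternating_prefix (R : pzRingType) h n : (h <= n)%N ->
  \sum_(0 <= m < n) (- 1) ^+ m * (m < h)%:R = (odd h)%:R :> R.
Proof.
move=> hn; rewrite (big_cat_nat (n := h)) //= [X in _ + X]big_seq.
rewrite [X in _ + X]big1 ?addr0 => [|i]; last first.
  by rewrite mem_index_iota leqNgt => /andP[/negbTE -> _]; rewrite mulr0.
rewrite (eq_big_nat _ _ (F2 := fun i => (- 1) ^+ i)); last first.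
  by move=> i /andP[_ ->]; rewrite mulr1.
elim: h {hn} => [|h IH]; first by rewrite big_geq.
rewrite big_nat_recr //= IH -signr_odd.
by case: (odd h); rewrite /= ?addrN // add0r.
Qed.

(** The indices m with the even start form an initial segment, bounded because 2m is then a part;
    the alternating sum over it is the parity of its length. *)
Lemma Prdo_alternating (R : pzRingType) p T : is_partition p -> (sumn p < T)%N ->
  (Prdo p)%:R = \sum_(0 <= m < T)
    (- 1) ^+ m * (distinct_odds p && starts_even p (2 * m + 1))%:R :> R.
Proof.
move=> hp pT.
have stT m : starts_even p (2 * m + 1) -> (m < T)%N.
  case: m => [|m] st; first by lia.
  have : (2 * m.+1)%N \in p by rewrite (starts_even_mem st); lia.
  by move/mem_le_sumn; lia.
have ex : exists m, ~~ starts_even p (2 * m + 1).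
  by exists T; apply/negP => /stT; rewrite ltnn.
case: (ex_minnP ex) => h hh hmin.
have H m : starts_even p (2 * m + 1) = (m < h)%N.
  apply/idP/idP => [st|mh]; last by apply: contraTT mh => /hmin; rewrite -leqNgt.
  rewrite ltnNge; apply/negP => hm; move/negP: hh; apply.
  by apply: starts_even_le st; lia.
rewrite (Prdo_odd hp H).
have hT : (h <= T)%N by apply: hmin; apply/negP => /stT; rewrite ltnn.
case: (distinct_odds p) => /=; last by rewrite big1 // => i _; rewrite mulr0.
by rewrite -(alternating_prefix _ hT); apply: eq_bigr => m _; rewrite H.
Qed.

(** * Extraction of coefficients *)

Lemma partitions_le_stable m n : (n <= m)%N -> partitions_le m n = partitions n.
Proof.
move=> /subnK <-; elim: (m - n)%N => // d IH; rewrite addSn partitions_leS.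
by rewrite divn_small ?ltnS ?leq_addl //= mul0n subn0 cats0 map_id.
Qed.

Lemma gen_series_GG2 n T : (n < T)%N ->
  gen_series GG2 omega2 n
  = \sum_(0 <= k < T) \sum_(p <- GG2_list T k | sumn p == n) omega2 p.
Proof.
move=> nT; transitivity (\sum_(0 <= k < T)
    \sum_(p <- partitions n | GG2 p && (size p == k)) omega2 p).
  rewrite (exchange_big_dep GG2) /=; last by move=> k p _ /andP[].
  rewrite /gen_series big_seq_cond [RHS]big_seq_cond.
  apply: eq_bigr => p /andP[]; rewrite mem_partitions => /andP[_ /eqP sp] gp.
  rewrite gp (eq_bigl (fun k => k == size p)) => [|k]; last by rewrite eq_sym.
  rewrite (big_nat1_eq _ (fun=> omega2 p)) ifT //=.
  apply: leq_ltn_trans nT; rewrite -sp.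
  (* Parts are positive, so there are at most n < T of them and the bound on k loses nothing. *)
  case/and3P: gp => p3 _ _; elim: p p3 {sp} => //= a p IH /andP[a3 /IH]; lia.
apply: eq_bigr => k _; rewrite -big_filter -[RHS]big_filter.
apply: perm_big; apply: uniq_perm; rewrite ?filter_uniq ?uniq_partitions //.
  exact: uniq_GG2_list.
move=> p; rewrite !mem_filter mem_partitions andbC.
case: (eqVneq (sumn p) n) => [sp|]; last by rewrite andbF.
rewrite /= mem_GG2_list ?sp // andbT; case: (boolP (GG2 p)) => [gp|];
  rewrite ?andbF //=.
suff -> : is_partition p by [].
rewrite /is_partition; case/and3P: gp => /allP p3 sp' _.
rewrite (sub_sorted _ sp') => [|x y /=]; last by lia.
by apply/negP => /p3.
Qed.

Lemma gen_series_Prdo n T : (n < T)%N ->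
  gen_series Prdo (fun=> 1) n = \sum_(0 <= m < T) (- 1) ^+ m *
    \sum_(p <- partitions n | freqs_in (allowed m) T.*2.+1 p) 1.
Proof.
move=> nT; under eq_bigr => m _ do rewrite mulr_sumr big_mkcond.
rewrite exchange_big /gen_series big_mkcond /=.
rewrite big_seq [RHS]big_seq; apply: eq_bigr => p.
rewrite mem_partitions => /andP[hp /eqP sp].
transitivity ((Prdo p)%:R : rat); first by case: (Prdo p).
rewrite (@Prdo_alternating _ p T) ?sp //; apply: eq_big_nat => m /andP[_ mT].
rewrite freqs_in_allowed ?sp //; last by case/andP: hp.
by case: ifP => _; rewrite ?mulr0.
Qed.

Section Truncation.

Variable n : nat.

Definition truncX : {poly %/ ('X^(n.+1) : {poly rat})} := in_qpoly 'X^(n.+1) 'X.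

Lemma truncX_nil : truncX ^+ n.+1 = 0.
Proof.
rewrite /truncX -rmorphXn; apply/val_inj => /=.
by rewrite mk_monic_Xn Pdiv.RingMonic.rmodpp // monicXn.
Qed.

Lemma coef_truncX k : (truncX ^+ k : {poly rat})`_n = (k == n)%:R.
Proof.
have [kn|nk] := leqP k n; last first.
  by rewrite (expr_nil truncX_nil) // coef0 gtn_eqF.
rewrite /truncX -rmorphXn in_qpoly_small ?coefXn 1?eq_sym //.
by rewrite mk_monic_Xn !size_polyXn ltnS.
Qed.

End Truncation.

Theorem theorem3p5 :
  gen_series GG2 omega2 =1 gen_series Prdo (fun _ => 1%R).
Proof.
move=> n; rewrite (gen_series_GG2 (ltnSn n)) (gen_series_Prdo (ltnSn n)).
have qT := truncX_nil n; set q := truncX n in qT; set T := n.+1 in q qT *.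
transitivity ((\sum_(0 <= k < T) \sum_(p <- GG2_list T k)
    omega2 p *: q ^+ sumn p : {poly rat})`_n).
  rewrite coefn_sum; apply: eq_bigr => k _; rewrite coefn_sum big_mkcond.
  apply: eq_bigr => p _; rewrite poly_of_qpolyZ coefZ coef_truncX.
  by case: eqP; rewrite ?mulr1 ?mulr0.
under eq_bigr => k _ do rewrite GG2_list_series //.
rewrite weighted_series_identity // mulr_sumr coefn_sum.
apply: eq_big_nat => m /andP[_ mT].
have -> : ipoch q T T * ((- 1) ^+ m * q ^+ (m * m.+1)
     * \prod_(0 <= i < T - m) (1 + q ^+ i.*2 * q ^+ (2 * m + 3)))
   = (- 1) ^+ m *: \sum_(0 <= s < T) \sum_(p <- partitions_le T.*2.+1 s
        | freqs_in (allowed m) T.*2.+1 p) q ^+ s.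
  rewrite freqs_in_series // allowed_prod ?(ltnW mT) //.
  by rewrite -[in RHS]signr_odd scaler_sign -mulr_sign signr_odd; ring.
rewrite poly_of_qpolyZ coefZ coefn_sum; congr (_ * _).
(* Only the last index s = n of the range contributes to the coefficient of q^n. *)
rewrite big_nat_recr // big1_seq ?Monoid.mul1m => [|s].
  rewrite coefn_sum partitions_le_stable; last by rewrite /T; lia.
  by apply: eq_bigr => p _; rewrite coef_truncX eqxx.
move=> /andP[_]; rewrite mem_index_iota => /andP[_ sn].
by rewrite coefn_sum big1 // => p _; rewrite coef_truncX ltn_eqF.
Qed.
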